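(* Let $A_1=P_1J_1P_1^{-1}$ with $J_1=\begin{pmatrix}-\alpha_1&\beta_1\\-\beta_1&-\alpha_1\end{pmatrix}$, $\alpha_1>0$, $\beta_1\ne0$, and $A_2=P_2J_2P_2^{-1}$ with $J_2=\begin{pmatrix}n_2&1\\0&n_2\end{pmatrix}$, $n_2\ge0$; here $P_1,P_2$ are real invertible $2\times 2$ matrices chosen such that $M=P_2^{-1}P_1=\begin{pmatrix}a&b\\c&d\end{pmatrix}$ has determinant $1$ or $-1$. Given $\eta>0$, let $$\tau_{2,1}(\eta)=\frac{n_2}{\alpha_1}\eta+\frac1{\alpha_1}\ln\theta(\eta)+\frac1{\alpha_1}\sinh^{-1}\sqrt{\frac14\left(c^2+d^2+\frac1{c^2+d^2}\right)^2-1}.$$ Then the switched system $\dot x(t)=A_{\sigma(t)}x(t)$ is stable for all $\sigma\in\mathcal S[\tau_{2,1}(\eta),\eta]$ and asymptotically stable for all $\sigma\in\mathcal S'[\tau_{2,1}(\eta),\eta]$.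
   Context: $\theta(t)=\left\|\begin{pmatrix}1&t\\0&1\end{pmatrix}\right\|=\sqrt{1+\frac{t^2}{2}+t\sqrt{1+\frac{t^2}{4}}}$ (spectral norm). Planar switched system: $\dot x(t)=A_{\sigma(t)}x(t)$, $x(t)\in\mathbb R^2$ continuous in $t\ge0$, with $A_1,A_2$ real $2\times2$ matrices. A switching signal $\sigma:[0,\infty)\to\{1,2\}$ is right-continuous and piecewise constant with infinitely many discontinuities $0<d_1<d_2<\cdots$, $d_k\to\infty$; set $d_0=0$. For a signal with $\sigma(0)=1$ put $t_k=d_{2k-1}-d_{2k-2}$ (times spent in $A_1$) and $s_k=d_{2k}-d_{2k-1}$ (times spent in $A_2$), $k\ge1$. For $\tau,\eta>0$, $\mathcal S[\tau,\eta]$ is the set of signals with $\sigma(0)=1$, $t_k\ge\tau$ and $s_k\le\eta$ for all $k\in\mathbb N$; $\mathcal S'[\tau,\eta]$ is the set of $\sigma\in\mathcal S[\tau,\eta]$ for which the sequence $(t_k,s_k)_{k\ge1}$ does not converge to $(\tau,\eta)$. For a given signal $\sigma$, the system is stable if for every $\varepsilon'>0$ there is $\delta>0$ such that $\|x(0)\|<\delta$ implies $\|x(t)\|<\varepsilon'$ for all $t>0$; it is asymptotically stable if it is stable and $\|x(t)\|\to0$ as $t\to\infty$ for every $x(0)\in\mathbb R^2$. Vector norms are Euclidean. *)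

(* Defs.v *)
From HB Require Import structures.
From mathcomp Require Import all_boot all_order all_algebra.
From mathcomp Require Import all_classical all_reals all_analysis.
From mathcomp Require Import ring lra.
Set Implicit Arguments.
Unset Strict Implicit.
Unset Printing Implicit Defensive.
Import Order.TTheory GRing.Theory Num.Theory.
Import numFieldNormedType.Exports.
Local Open Scope classical_set_scope.
Local Open Scope ring_scope.

Definition mx22 (R : Type) (a b c d : R) : 'M[R]_2 :=
  \matrix_(i < 2, j < 2)
    if i == ord0 then (if j == ord0 then a else b)
    else (if j == ord0 then c else d).

(* The library norm on matrices is the sup norm, hence these two. *)
Definition enorm (R : realType) (n : nat) (v : 'cV[R]_n) : R :=
  Num.sqrt (\sum_(i < n) v i ord0 ^+ 2).

Definition spectral_norm (R : realType) (m n : nat) (A : 'M[R]_(m, n)) : R :=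
  sup [set enorm (A *m v) | v in [set v : 'cV[R]_n | enorm v <= 1]].

Definition theta (R : realType) (t : R) : R := spectral_norm (mx22 1 t 0 1).

Definition sinh (R : realType) (x : R) : R := (expR x - expR (- x)) / 2.

(* The inverse function of sinh; see sinhK and asinhK. *)
Definition asinh (R : realType) (x : R) : R := ln (x + Num.sqrt (x ^+ 2 + 1)).

Inductive mode : Set := Mode1 | Mode2.

Definition subsystem (R : realType) (A1 A2 : 'M[R]_2) (i : mode) : 'M[R]_2 :=
  match i with Mode1 => A1 | Mode2 => A2 end.

(* Signals are functions on R whose values at negative times are irrelevant.
   The half-open intervals make sigma right-continuous, and the last clause
   makes every d k with 0 < k a genuine discontinuity. *)
Definition switching_times (R : realType) (sigma : R -> mode) (d : nat -> R) :
    Prop :=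
  [/\ d 0%N = 0,
      forall k : nat, d k < d k.+1,
      d k @[k --> \oo] --> +oo,
      forall (k : nat) (t : R), d k <= t < d k.+1 -> sigma t = sigma (d k)
    & forall k : nat, sigma (d k.+1) <> sigma (d k)].

(* Durations of the k-th stays in A1 and in A2, with k counted from 0, for a
   signal starting in Mode1. *)
Definition stay1 (R : realType) (d : nat -> R) (k : nat) : R :=
  d (2 * k).+1 - d (2 * k)%N.
Definition stay2 (R : realType) (d : nat -> R) (k : nat) : R :=
  d (2 * k).+2 - d (2 * k).+1.

Definition sigS (R : realType) (tau eta : R) : set (R -> mode) :=
  [set sigma | sigma 0 = Mode1 /\
    exists2 d : nat -> R, switching_times sigma d &
      forall k : nat, tau <= stay1 d k /\ stay2 d k <= eta].

Definition sigS' (R : realType) (tau eta : R) : set (R -> mode) :=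
  [set sigma | sigS tau eta sigma /\
    exists2 d : nat -> R, switching_times sigma d &
      ~ ((stay1 d k, stay2 d k) @[k --> \oo] --> (tau, eta))].

(* The differential equation is required at all times t > 0 at which the signal
   is locally constant, i.e. except at the switching times. *)
Definition switched_solution (R : realType) (A1 A2 : 'M[R]_2)
    (sigma : R -> mode) (x : R -> 'cV[R]_2) : Prop :=
  {within [set t | 0 <= t], continuous x} /\
  forall t : R, 0 < t -> (\forall s \near t, sigma s = sigma t) ->
    is_derive t 1 x (subsystem A1 A2 (sigma t) *m x t).

Definition switched_stable (R : realType) (A1 A2 : 'M[R]_2)
    (sigma : R -> mode) : Prop :=
  forall eps : R, 0 < eps -> exists2 delta : R, 0 < delta &
    forall x : R -> 'cV[R]_2, switched_solution A1 A2 sigma x ->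
      enorm (x 0) < delta -> forall t : R, 0 < t -> enorm (x t) < eps.

Definition switched_asymp_stable (R : realType) (A1 A2 : 'M[R]_2)
    (sigma : R -> mode) : Prop :=
  switched_stable A1 A2 sigma /\
  forall x : R -> 'cV[R]_2, switched_solution A1 A2 sigma x ->
    enorm (x t) @[t --> +oo] --> (0 : R).

(* c and d are the entries of the second row of invmx P2 *m P1. *)
Definition tau21 (R : realType) (alpha1 n2 c d eta : R) : R :=
  n2 / alpha1 * eta + alpha1^-1 * ln (theta eta)
  + alpha1^-1 *
    asinh (Num.sqrt (4^-1 * (c ^+ 2 + d ^+ 2 + (c ^+ 2 + d ^+ 2)^-1) ^+ 2 - 1)).

Lemma asinhK (R : realType) (x : R) : sinh (asinh x) = x.
Proof.
have h0 : 0 <= x ^+ 2 + 1 by nra.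
have s0 := sqrtr_ge0 (x ^+ 2 + 1).
have s2 := sqr_sqrtr h0.
have p : 0 < x + Num.sqrt (x ^+ 2 + 1) by nra.
rewrite /sinh /asinh expRN lnK ?posrE //.
by move: p s2; move: (Num.sqrt _) => s p s2; field: s2; rewrite gt_eqF.
Qed.

Lemma sinhK (R : realType) (x : R) : asinh (sinh x) = x.
Proof.
rewrite /asinh /sinh -[RHS]expRK; congr ln.
have e0 := expR_gt0 x.
have -> : ((expR x - expR (- x)) / 2) ^+ 2 + 1
    = ((expR x + expR (- x)) / 2) ^+ 2.
  by rewrite expRN; field; rewrite gt_eqF.
rewrite sqrtr_sqr ger0_norm; first by field.
by rewrite divr_ge0 // addr_ge0 ?expR_ge0.
Qed.

Lemma thetaE (R : realType) (t : R) : 0 <= t ->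
  theta t = Num.sqrt (1 + t ^+ 2 / 2 + t * Num.sqrt (1 + t ^+ 2 / 4)).
Proof.
move=> t0; have h0 : 0 <= 1 + t ^+ 2 / 4 by nra.
have := sqr_sqrtr h0; have := sqrtr_ge0 (1 + t ^+ 2 / 4).
set s := Num.sqrt (1 + t ^+ 2 / 4) => s0 s2.
pose m := t / 2 + s.
have m0 : 0 < m by rewrite /m; nra.
have m2 : m ^+ 2 = t * m + 1 by rewrite /m; nra.
have -> : 1 + t ^+ 2 / 2 + t * s = m ^+ 2 by rewrite m2 /m; field.
rewrite sqrtr_sqr (gtr0_norm m0).
have nE (v : 'cV[R]_2) :
    enorm v = Num.sqrt (v ord0 ord0 ^+ 2 + v (lift ord0 ord0) ord0 ^+ 2).
  by rewrite /enorm !big_ord_recl big_ord0 addr0.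
have AE (v : 'cV[R]_2) : enorm (mx22 1 t 0 1 *m v) =
    Num.sqrt ((v ord0 ord0 + t * v (lift ord0 ord0) ord0) ^+ 2
              + v (lift ord0 ord0) ord0 ^+ 2).
  rewrite nE !mxE !big_ord_recl !big_ord0 !mxE /= !addr0 !mul1r.
  by rewrite mul0r add0r.
have ub : ubound [set enorm (mx22 1 t 0 1 *m v)
                 | v in [set v : 'cV[R]_2 | enorm v <= 1]] m.
  move=> _ [v /= + <-]; rewrite nE AE.
  move: (v ord0 ord0) (v (lift ord0 ord0) ord0) => x y.
  rewrite -[in X in X -> _]sqrtr1 ler_sqrt // => xy.
  rewrite -(ger0_norm (ltW m0)) -sqrtr_sqr ler_wsqrtr //.
  have : 0 <= t * (m * x - y) ^+ 2 by rewrite mulr_ge0 // sqr_ge0.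
  have key : m * (m ^+ 2 * (x ^+ 2 + y ^+ 2) - (x + t * y) ^+ 2 - y ^+ 2)
     = t * (m * x - y) ^+ 2.
    have -> : t = m - m^-1.
      apply: (mulIf (lt0r_neq0 m0)); rewrite mulrBl mulVf ?gt_eqF //.
      by rewrite -expr2 m2 addrK.
    by field; rewrite gt_eqF.
  rewrite -key pmulr_rge0 // => H.
  have : m ^+ 2 * (x ^+ 2 + y ^+ 2) <= m ^+ 2 by rewrite ler_piMr ?sqr_ge0.
  lra.
apply/le_anti/andP; split.
  apply: ge_sup ub; exists (enorm (mx22 1 t 0 1 *m 0)), 0 => //=.
  by rewrite nE !mxE expr0n addr0 sqrtr0.
apply: ub_le_sup; first by exists m.
pose q := Num.sqrt (1 + m ^+ 2).
have q2 : q ^+ 2 = 1 + m ^+ 2 by rewrite sqr_sqrtr //; nra.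
have q0 : 0 < q by rewrite sqrtr_gt0; nra.
clearbody m q.
exists (\col_i if i == ord0 then q^-1 else m / q).
  rewrite /= nE !mxE /= -[leRHS]sqrtr1 ler_sqrt // exprMn exprVn q2.
  by rewrite le_eqVlt; apply/orP; left; apply/eqP; field; nra.
rewrite AE !mxE /= -[RHS](ger0_norm (ltW m0)) -sqrtr_sqr; congr Num.sqrt.
have -> : q^-1 + t * (m / q) = m ^+ 2 / q by rewrite m2 mulrDl mul1r mulrA addrC.
by rewrite !exprMn exprVn q2; field; nra.
Qed.

(* Main.v *)
Require Import Defs.
From mathcomp Require Import all_boot all_order all_algebra.
From mathcomp Require Import all_classical all_reals all_analysis.
From mathcomp Require Import ring lra zify.
Import Order.TTheory GRing.Theory Num.Theory.
Import numFieldNormedType.Exports.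
Local Open Scope classical_set_scope.
Local Open Scope ring_scope.

Set Implicit Arguments.
Unset Strict Implicit.
Unset Printing Implicit Defensive.

(** The state is observed in the coordinates y = P1^-1 x, in which the first
    mode is a rotation damped by the factor exp (- alpha1 t): during a stay of
    length t in mode 1 the norm of y is multiplied by exactly exp (- alpha1 t)
    ([spiral_enorm]).  With U s the shear of parameter s, a stay of length s in
    mode 2 multiplies y by the matrix exp (n2 s) M^-1 (U s) M
    ([jordan_flow]).  Since det M = 1 or -1, the nilpotent part of
    M^-1 (U s) M is, up to sign, s times the product of the column (d, -c) and
    the row (c, d), two orthogonal vectors of squared length
    q = c^2 + d^2; in the corresponding orthogonal axes it is the shear of
    parameter q s, so its norm is theta (q s) ([conj_shear_enorm]).

    One cycle therefore multiplies the norm of y by at most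
    exp (n2 s) theta (q s) exp (- alpha1 t), called [cycle_gain].  The number
    theta t is the positive root m of m^2 = t m + 1, whence
    theta (q s) <= K theta s for K = max (q, 1/q) ([theta_scale]), and the
    inverse hyperbolic sine in the formula for tau is just ln K
    ([asinh_dwell]).  So tau is the dwell time for which
    exp (n2 eta) K theta (eta) exp (- alpha1 tau) = 1 ([tau21_balance]), and the
    gain of every admissible cycle is at most 1: this gives stability.

    If the stays do not converge to (tau, eta), then for some e > 0 infinitely
    many cycles have t >= tau + e or s <= eta - e.  As the gain is strictly
    monotone in both stays, those cycles contract by one common factor r < 1
    ([cycle_gain_uniform]); the norms at the beginning of the cycles
    do not increase, hence tend to 0 ([cvg0_contraction]), and the norm within a cycle is at
    most a constant times the norm at its beginning. *)

(** * Plane vectors *)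

Local Notation cx v := (v ord0 ord0).
Local Notation cy v := (v (lift ord0 ord0) ord0).

Lemma enorm_ge0 (R : realType) (n : nat) (v : 'cV[R]_n) : 0 <= enorm v.
Proof. exact: sqrtr_ge0. Qed.

Lemma enormE (R : realType) (v : 'cV[R]_2) :
  enorm v = Num.sqrt (cx v ^+ 2 + cy v ^+ 2).
Proof. by rewrite /enorm !big_ord_recl big_ord0 addr0. Qed.

Lemma enorm_sqr (R : realType) (v : 'cV[R]_2) :
  enorm v ^+ 2 = cx v ^+ 2 + cy v ^+ 2.
Proof. by rewrite enormE sqr_sqrtr // addr_ge0 ?sqr_ge0. Qed.

Lemma enorm_leP (R : realType) (v : 'cV[R]_2) (r : R) : 0 <= r ->
  cx v ^+ 2 + cy v ^+ 2 <= r ^+ 2 -> enorm v <= r.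
Proof.
move=> r0; rewrite -enorm_sqr => /(ler_wsqrtr).
by rewrite !sqrtr_sqr !ger0_norm ?enorm_ge0.
Qed.

Lemma enormZ (R : realType) (r : R) (v : 'cV[R]_2) : 0 <= r ->
  enorm (r *: v) = r * enorm v.
Proof.
move=> r0; rewrite !enormE !mxE !exprMn -mulrDr sqrtrM ?sqr_ge0 //.
by rewrite sqrtr_sqr ger0_norm.
Qed.

Lemma col2P (R : realType) (v w : 'cV[R]_2) :
  cx v = cx w -> cy v = cy w -> v = w.
Proof.
move=> ex ey; apply/matrixP => i j; rewrite (ord1 j).
by case: (unliftP ord0 i) => [k ->|-> //]; rewrite (ord1 k).
Qed.

Lemma mulmx_cx (R : realType) (A : 'M[R]_2) (v : 'cV[R]_2) :
  cx (A *m v) = A ord0 ord0 * cx v + A ord0 (lift ord0 ord0) * cy v.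
Proof. by rewrite mxE !big_ord_recl big_ord0 addr0. Qed.

Lemma mulmx_cy (R : realType) (A : 'M[R]_2) (v : 'cV[R]_2) :
  cy (A *m v) = A (lift ord0 ord0) ord0 * cx v
                + A (lift ord0 ord0) (lift ord0 ord0) * cy v.
Proof. by rewrite mxE !big_ord_recl big_ord0 addr0. Qed.

Lemma mx22_cx (R : realType) (a b c d : R) (v : 'cV[R]_2) :
  cx (mx22 a b c d *m v) = a * cx v + b * cy v.
Proof. by rewrite mulmx_cx !mxE. Qed.

Lemma mx22_cy (R : realType) (a b c d : R) (v : 'cV[R]_2) :
  cy (mx22 a b c d *m v) = c * cx v + d * cy v.
Proof. by rewrite mulmx_cy !mxE. Qed.

Lemma det_mx22 (R : realType) (a b c d : R) :
  \det (mx22 a b c d) = a * d - b * c.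
Proof.
rewrite (expand_det_row _ ord0) !big_ord_recl big_ord0 addr0 /cofactor !mxE /=.
by rewrite !det_mx11 !mxE /= expr0 expr1; ring.
Qed.

Lemma enorm_mulmx_le (R : realType) (A : 'M[R]_2) :
  exists2 C : R, 0 < C & forall v : 'cV[R]_2, enorm (A *m v) <= C * enorm v.
Proof.
set p := A ord0 ord0; set q := A ord0 (lift ord0 ord0).
set r := A (lift ord0 ord0) ord0; set s := A (lift ord0 ord0) (lift ord0 ord0).
pose C2 := 1 + p ^+ 2 + q ^+ 2 + r ^+ 2 + s ^+ 2.
have C2_gt0 : 0 < C2 by rewrite /C2; nra.
exists (Num.sqrt C2); first by rewrite sqrtr_gt0.
move=> v; apply: enorm_leP; first by rewrite mulr_ge0 ?sqrtr_ge0 ?enorm_ge0.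
rewrite exprMn (sqr_sqrtr (ltW C2_gt0)) enorm_sqr mulmx_cx mulmx_cy -/p -/q -/r -/s.
rewrite /C2; move: (cx v) (cy v) => x y.
have h1 := sqr_ge0 (p * y - q * x); have h2 := sqr_ge0 (r * y - s * x).
by have hx := sqr_ge0 x; have hy := sqr_ge0 y; nra.
Qed.

(** * Linear systems on an interval *)

(** Differential equations are read entrywise, so that only calculus of real
    functions is involved. *)
Definition solves_on (R : realType) (A : 'M[R]_2) (u v : R) (x : R -> 'cV[R]_2) :
    Prop :=
  forall i : 'I_2, {within `[u, v], continuous (fun t => x t i ord0)} /\
    forall t : R, u < t < v ->
      is_derive t 1 (fun s => x s i ord0) ((A *m x t) i ord0).

Lemma is_derive_coord (R : realType) (x : R -> 'cV[R]_2) (D : 'cV[R]_2) (t : R)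
    (i : 'I_2) :
  is_derive t 1 x D -> is_derive t 1 (fun s => x s i ord0) (D i ord0).
Proof.
move=> [dx Dx]; split; first exact: ((derivable_mxP x t 1).1 dx).
by rewrite -Dx derive_mx // mxE.
Qed.

(** The differential equations are solved by conserved quantities: an expression
    of the state and of time whose derivative along the solution is 0. *)
Lemma derive0_cst (R : realType) (f : R -> R) (u v : R) :
  {within `[u, v], continuous f} ->
  (forall t, u < t < v -> is_derive t 1 f 0) ->
  forall t, u <= t <= v -> f t = f u.
Proof.
move=> cf df t /andP[ut tv].
have [||w _ /eqP] := @MVT_segment R f (fun=> 0) u t ut.
- by move=> w; rewrite in_itv /= => /andP[uw wt]; apply: df; rewrite uw (lt_le_trans wt).
- apply: continuous_subspaceW cf => w /=; rewrite !in_itv /=.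
  by move=> /andP[-> /le_trans->].
by rewrite mul0r subr_eq0 => /eqP.
Qed.

Lemma within_continuous_expR (R : realType) (A : set R) (k u : R) :
  {within A, continuous (fun t => expR (k * (t - u)))}.
Proof.
apply: continuous_subspaceT => t.
apply: (@continuous_comp _ _ _ (fun t => k * (t - u)) expR); last first.
  exact: continuous_expR.
apply: cvgM; first exact: cvg_cst.
by apply: cvgB; [exact: cvg_id|exact: cvg_cst].
Qed.

Lemma is_derive_expR_affine (R : realType) (k u t : R) :
  is_derive t 1 (fun t => expR (k * (t - u))) (k * expR (k * (t - u))).
Proof.
have h : is_derive t 1 (fun t => k * (t - u)) k.
  have := is_deriveZ k (is_deriveB (is_derive_id t 1) (is_derive_cst u t 1)).
  by move=> H; apply: (is_derive_eq H); rewrite subr0 /GRing.scale /= mulr1.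
by have := @is_derive1_comp _ expR (fun t => k * (t - u)) t _ _
  (is_derive_expR (k * (t - u))) h; rewrite mulrC.
Qed.

Lemma is_derive_mul (R : realType) (f g : R -> R) (t df dg : R) :
  is_derive t 1 f df -> is_derive t 1 g dg ->
  is_derive t 1 (fun s => f s * g s) (f t * dg + g t * df).
Proof. exact: is_deriveM. Qed.

Lemma is_derive_add (R : realType) (f g : R -> R) (t df dg : R) :
  is_derive t 1 f df -> is_derive t 1 g dg ->
  is_derive t 1 (fun s => f s + g s) (df + dg).
Proof. exact: is_deriveD. Qed.

Lemma solves_on_conj (R : realType) (P J : 'M[R]_2) (u v : R)
    (x : R -> 'cV[R]_2) : P \in unitmx ->
  solves_on (P *m J *m invmx P) u v x ->
  solves_on J u v (fun t => invmx P *m x t).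
Proof.
move=> Pu sx i.
have -> : (fun t => (invmx P *m x t) i ord0) = fun t =>
    invmx P i ord0 * cx (x t) + invmx P i (lift ord0 ord0) * cy (x t).
  by apply/funext => t; rewrite mxE !big_ord_recl big_ord0 addr0.
have [c0 d0] := sx ord0; have [c1 d1] := sx (lift ord0 ord0).
split.
  move=> t; apply: cvgD; apply: cvgM; try exact: cvg_cst.
    exact: c0.
  exact: c1.
move=> t tuv; have := is_derive_add
  (is_derive_mul (is_derive_cst (invmx P i ord0) t 1) (d0 _ tuv))
  (is_derive_mul (is_derive_cst (invmx P i (lift ord0 ord0)) t 1) (d1 _ tuv)).
move=> H; apply: (is_derive_eq H); rewrite /cst !mulr0 !addr0.
transitivity ((invmx P *m (P *m J *m invmx P *m x t)) i ord0).
  by rewrite [RHS]mxE !big_ord_recl big_ord0 addr0.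
by rewrite !mulmxA mulVmx // mul1mx.
Qed.

(** exp (2 alpha (t - u)) |y t|^2 is conserved, the rotation part contributing
    nothing to the derivative of |y t|^2. *)
Lemma spiral_enorm (R : realType) (alpha beta u v : R) (y : R -> 'cV[R]_2) :
  solves_on (mx22 (- alpha) beta (- beta) (- alpha)) u v y ->
  forall t, u <= t <= v -> enorm (y t) = expR (- alpha * (t - u)) * enorm (y u).
Proof.
move=> sy t tuv; have [c0 d0] := sy ord0; have [c1 d1] := sy (lift ord0 ord0).
pose f s := expR (2 * alpha * (s - u)) *
  (cx (y s) * cx (y s) + cy (y s) * cy (y s)).
have : f t = f u.
  apply: (@derive0_cst _ f u v) => // [s|s suv].
    apply: cvgM; first exact: within_continuous_expR.
    by apply: cvgD; apply: cvgM; first [exact: c0|exact: c1].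
  have d0s := d0 _ suv; have d1s := d1 _ suv.
  have := is_derive_mul (is_derive_expR_affine (2 * alpha) u s)
    (is_derive_add (is_derive_mul d0s d0s) (is_derive_mul d1s d1s)).
  by move=> H; apply: (is_derive_eq H); rewrite mx22_cx mx22_cy; ring.
rewrite /f subrr mulr0 expR0 mul1r -!expr2 -!enorm_sqr => /(congr1 Num.sqrt).
rewrite [X in _ = X]sqrtr_sqr ger0_norm ?enorm_ge0 // => <-.
have -> : 2 * alpha * (t - u) = alpha * (t - u) + alpha * (t - u) by ring.
rewrite expRD -expr2 -exprMn sqrtr_sqr ger0_norm; last first.
  by rewrite mulr_ge0 ?expR_ge0 ?enorm_ge0.
by rewrite mulrA -expRD mulNr addNr expR0 mul1r.
Qed.

(** Up to the factor exp (- n (t - u)), the second entry of z and the first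
    entry corrected by - (t - u) times the second are conserved. *)
Lemma jordan_flow (R : realType) (n u v : R) (z : R -> 'cV[R]_2) :
  solves_on (mx22 n 1 0 n) u v z ->
  forall t, u <= t <= v ->
    z t = expR (n * (t - u)) *: (mx22 1 (t - u) 0 1 *m z u).
Proof.
move=> sz t tuv; have [c0 d0] := sz ord0; have [c1 d1] := sz (lift ord0 ord0).
have E s : expR (n * (s - u)) * expR (- n * (s - u)) = 1.
  by rewrite -expRD mulNr subrr expR0.
pose f1 s := expR (- n * (s - u)) * cy (z s).
have f1E : f1 t = f1 u.
  apply: (@derive0_cst _ f1 u v) => // [s|s suv].
    by apply: cvgM; [exact: within_continuous_expR|exact: c1].
  have := is_derive_mul (is_derive_expR_affine (- n) u s) (d1 _ suv).
  by move=> H; apply: (is_derive_eq H); rewrite mx22_cy; ring.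
pose f0 s := expR (- n * (s - u)) * (cx (z s) + (u - s) * cy (z s)).
have f0E : f0 t = f0 u.
  apply: (@derive0_cst _ f0 u v) => // [s|s suv].
    apply: cvgM; first exact: within_continuous_expR.
    apply: cvgD; first exact: c0.
    apply: cvgM; last exact: c1.
    apply: (@continuous_subspaceT _ _ _ (fun s => u - s)) => w.
    by apply: cvgB; [exact: cvg_cst|exact: cvg_id].
  have := is_derive_mul (is_derive_expR_affine (- n) u s)
    (is_derive_add (d0 _ suv) (is_derive_mul
      (is_deriveB (is_derive_cst u s 1) (is_derive_id s 1)) (d1 _ suv))).
  move=> H; apply: (is_derive_eq H); rewrite mx22_cx mx22_cy /cst.
  by rewrite [(_ - _) s]/(u - s); ring.
move: f1E f0E; rewrite /f1 /f0 subrr mulr0 expR0 !mul1r mul0r addr0 => f1E f0E.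
have Et := E t.
by apply: col2P; rewrite [RHS]mxE ?mx22_cx ?mx22_cy -?f0E -f1E; ring: Et.
Qed.

(** * The shear norm and the dwell time *)

(** The closed form of theta t is the square root of (t/2 + sqrt (1 + t^2/4))^2,
    that is, the positive root of m^2 = t m + 1; all properties of theta are
    derived from this equation. *)
Lemma theta_root (R : realType) (t : R) : 0 <= t ->
  0 < theta t /\ theta t ^+ 2 = t * theta t + 1.
Proof.
move=> t0; rewrite thetaE //; set s := Num.sqrt (1 + t ^+ 2 / 4).
have s2 : s ^+ 2 = 1 + t ^+ 2 / 4 by rewrite sqr_sqrtr //; nra.
have s0 : 0 < s by rewrite sqrtr_gt0; nra.
have -> : 1 + t ^+ 2 / 2 + t * s = (t / 2 + s) ^+ 2.
  by rewrite sqrrD s2; field.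
have m0 : 0 < t / 2 + s by nra.
rewrite sqrtr_sqr gtr0_norm //; split=> //.
by rewrite sqrrD s2 mulrDr; field: s2.
Qed.

Lemma theta_gt (R : realType) (t : R) : 0 <= t -> t < theta t.
Proof.
by move=> t0; have [p0 p2] := theta_root t0; rewrite -(ltr_pM2r p0) -expr2 p2 ltrDl.
Qed.

(** A positive m with t m + 1 <= m^2 lies above the positive root of
    m^2 - t m - 1. *)
Lemma theta_le (R : realType) (t m : R) : 0 <= t -> 0 < m ->
  t * m + 1 <= m ^+ 2 -> theta t <= m.
Proof.
move=> t0 m0 hm; have [p0 p2] := theta_root t0.
have tp := theta_gt t0.
rewrite leNgt; apply/negP => mp.
have : 0 < (theta t - m) * (theta t + m - t) by apply: mulr_gt0; lra.
by nra.
Qed.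

Lemma theta_mono (R : realType) (s t : R) : 0 <= s -> s < t ->
  theta s < theta t.
Proof.
move=> s0 st; have [p0 p2] := theta_root s0.
have [m0 m2] := theta_root (le_trans s0 (ltW st)).
rewrite ltNge; apply/negP => mp.
have sp := theta_gt s0.
have : 0 <= (theta s - theta t) * (theta s + theta t - s) by apply: mulr_ge0; lra.
have : 0 < (t - s) * theta t by apply: mulr_gt0; lra.
by nra.
Qed.

Lemma theta_homo (R : realType) (s t : R) : 0 <= s -> s <= t ->
  theta s <= theta t.
Proof.
by move=> s0; rewrite le_eqVlt => /orP[/eqP->//|/(theta_mono s0)/ltW].
Qed.

Lemma maxV_ge1 (R : realType) (q : R) : 0 < q -> 1 <= Num.max q q^-1.
Proof.
move=> q0; rewrite le_max; have [//|q1] := leP 1 q.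
by rewrite invf_ge1 // (ltW q1).
Qed.

(** Since K = max (q, 1/q) satisfies K >= q and K >= 1, the equation for
    theta t yields q t (K theta t) + 1 <= (K theta t)^2. *)
Lemma theta_scale (R : realType) (q t : R) : 0 < q -> 0 <= t ->
  theta (q * t) <= Num.max q q^-1 * theta t.
Proof.
move=> q0 t0; have [p0 p2] := theta_root t0; have K1 := maxV_ge1 q0.
have qK : q <= Num.max q q^-1 by rewrite le_max lexx.
move: K1 qK; set K := Num.max _ _ => K1 qK.
apply: theta_le; [by rewrite mulr_ge0 // ltW|by rewrite mulr_gt0 //; lra|].
rewrite exprMn p2 mulrDr mulr1 lerD ?exprn_ege1 //.
have -> : q * t * (K * theta t) = q * (K * (t * theta t)) by ring.
by rewrite expr2 -mulrA ler_wpM2r // mulr_ge0 ?mulr_ge0 // ?(ltW p0) //; lra.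
Qed.

(** A zero row would make the determinant vanish. *)
Lemma row_sqr_gt0 (R : realType) (a b c d : R) :
  (a * d - b * c) ^+ 2 = 1 -> 0 < c ^+ 2 + d ^+ 2.
Proof.
move=> e2; rewrite lt0r addr_ge0 ?sqr_ge0 // andbT paddr_eq0 ?sqr_ge0 // !sqrf_eq0.
apply/negP => /andP[/eqP c0 /eqP d0].
by move/eqP: e2; rewrite c0 d0 !mulr0 subrr expr0n eq_sym oner_eq0.
Qed.

(** Put e = ad - bc, X = dy0 - cy1 and Y = cy0 + dy1, so that
    X^2 + Y^2 = q |y|^2.  In these axes the conjugated shear sends (X, eY) to
    (X + qs eY, eY), and m = theta (qs) satisfies m^2 = qs m + 1; up to
    positive factors, the gap between the squares of the two sides is then a
    perfect square, see [key] in the proof. *)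
Lemma conj_shear_enorm (R : realType) (a b c d s : R) (y w : 'cV[R]_2) :
  (a * d - b * c) ^+ 2 = 1 -> 0 <= s ->
  mx22 a b c d *m w = mx22 1 s 0 1 *m (mx22 a b c d *m y) ->
  enorm w <= theta ((c ^+ 2 + d ^+ 2) * s) * enorm y.
Proof.
move=> e2 s0 wE; set q := c ^+ 2 + d ^+ 2.
have q0 : 0 < q := row_sqr_gt0 e2.
have h0 := congr1 (fun v : 'cV_2 => cx v) wE.
have h1 := congr1 (fun v : 'cV_2 => cy v) wE.
have t0 : 0 <= q * s by rewrite mulr_ge0 // ltW.
have [m0 m2] := theta_root t0; move: m0 m2.
move: h0 h1 => /=; rewrite !(mx22_cx, mx22_cy) !mul1r mul0r add0r.
set m := theta _ => h0 h1 m0 m2.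
apply: enorm_leP; first by rewrite mulr_ge0 ?enorm_ge0 // ltW.
rewrite exprMn enorm_sqr.
move: (cx w) (cy w) (cx y) (cy y) h0 h1 => w0 w1 y0 y1 h0 h1.
pose e := a * d - b * c; pose X := d * y0 - c * y1; pose Y := c * y0 + d * y1.
(* Cramer's rule for M w = U M y, with 1/e = e. *)
have w0E : w0 = y0 + e * s * d * Y.
  transitivity (e ^+ 2 * w0); first by rewrite e2 mul1r.
  have -> : e ^+ 2 * w0 = e * (d * (a * w0 + b * w1) - b * (c * w0 + d * w1)).
    by rewrite /e; ring.
  by rewrite h0 h1 -[y0 in RHS]mul1r -e2 /e /Y; ring.
have w1E : w1 = y1 - e * s * c * Y.
  transitivity (e ^+ 2 * w1); first by rewrite e2 mul1r.
  have -> : e ^+ 2 * w1 = e * (a * (c * w0 + d * w1) - c * (a * w0 + b * w1)).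
    by rewrite /e; ring.
  by rewrite h0 h1 -[y1 in RHS]mul1r -e2 /e /Y; ring.
have key : q * m * (m ^+ 2 * (y0 ^+ 2 + y1 ^+ 2) - (w0 ^+ 2 + w1 ^+ 2)) =
    q * s * (m * X - e * Y) ^+ 2.
  have eY : (e * Y) ^+ 2 = Y ^+ 2 by rewrite exprMn [e ^+ 2]e2 mul1r.
  transitivity
    (m * (m ^+ 2 * (X ^+ 2 + Y ^+ 2) - (X + q * s * (e * Y)) ^+ 2 - Y ^+ 2)).
    by rewrite w0E w1E /X /Y /q; clearbody e; ring.
  by rewrite -eY; move: (e * Y) X m2 => Z {}X m2; ring: m2.
have : 0 <= q * m * (m ^+ 2 * (y0 ^+ 2 + y1 ^+ 2) - (w0 ^+ 2 + w1 ^+ 2)).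
  by rewrite key mulr_ge0 ?sqr_ge0.
by rewrite pmulr_rge0 ?mulr_gt0 // subr_ge0.
Qed.

(** With K = max (q, 1/q) one has q + 1/q = K + 1/K, and the radicand is the
    square of (K - 1/K) / 2 = sinh (ln K). *)
Lemma asinh_dwell (R : realType) (q : R) : 0 < q ->
  asinh (Num.sqrt (4^-1 * (q + q^-1) ^+ 2 - 1)) = ln (Num.max q q^-1).
Proof.
move=> q0; have K1 := maxV_ge1 q0.
have -> : q + q^-1 = Num.max q q^-1 + (Num.max q q^-1)^-1.
  by rewrite maxEle; case: ifP => _; rewrite ?invrK // addrC.
move: K1; set K := Num.max _ _ => K1; have K0 : 0 < K by lra.
have Kn0 : K != 0 by rewrite gt_eqF.
rewrite -[RHS]sinhK /sinh expRN lnK //; congr asinh.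
have -> : 4^-1 * (K + K^-1) ^+ 2 - 1 = ((K - K^-1) / 2) ^+ 2 by field.
rewrite sqrtr_sqr ger0_norm // divr_ge0 // subr_ge0.
by rewrite (le_trans _ K1) // invf_le1.
Qed.

(** Bound for the factor by which the norm of P1^-1 x grows over a stay of length
    t in mode 1 followed by one of length s in mode 2. *)
Definition cycle_gain (R : realType) (alpha n q t s : R) : R :=
  expR (n * s) * theta (q * s) * expR (- alpha * t).

(** tau is the dwell time at which the damping in mode 1 exactly offsets the
    bound on the growth in mode 2 that [theta_scale] gives for the stay eta. *)
Lemma tau21_balance (R : realType) (alpha n c d eta : R)
    (q := c ^+ 2 + d ^+ 2) :
  0 < alpha -> 0 < q -> 0 < eta ->
  expR (n * eta) * (Num.max q q^-1 * theta eta) *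
    expR (- alpha * tau21 alpha n c d eta) = 1.
Proof.
move=> a0 q0 eta0; have K1 := maxV_ge1 q0; have [m0 _] := theta_root (ltW eta0).
rewrite /tau21 -/q asinh_dwell //; move: K1; set K := Num.max _ _ => K1.
have K0 : 0 < K by lra.
have -> : - alpha * (n / alpha * eta + alpha^-1 * ln (theta eta) + alpha^-1 * ln K)
   = - (n * eta) - ln (theta eta) - ln K by field; rewrite gt_eqF.
rewrite !expRD !expRN !lnK ?posrE //; field.
by rewrite !gt_eqF // expR_gt0.
Qed.

Lemma cycle_gain_le1 (R : realType) (alpha n c d eta t s : R)
    (q := c ^+ 2 + d ^+ 2) :
  0 < alpha -> 0 <= n -> 0 < q -> 0 < eta ->
  tau21 alpha n c d eta <= t -> 0 <= s <= eta ->
  cycle_gain alpha n q t s <= 1.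
Proof.
move=> a0 n0 q0 eta0 tt /andP[s0 se].
have [m0 _] := theta_root (mulr_ge0 (ltW q0) s0).
rewrite -(tau21_balance n a0 q0 eta0) /cycle_gain.
apply: ler_pM; rewrite ?mulr_ge0 ?expR_ge0 // ?(ltW m0) //.
  apply: ler_pM; rewrite ?expR_ge0 ?(ltW m0) // ?ler_expR ?ler_wpM2l //.
  rewrite (le_trans _ (theta_scale q0 (ltW eta0))) // theta_homo //.
    by rewrite mulr_ge0 // ltW.
  by rewrite ler_wpM2l // ltW.
by rewrite ler_expR !mulNr lerN2 ler_wpM2l // ltW.
Qed.

(** A stay in mode 1 longer by e gains a factor exp (- alpha e); a stay in mode 2
    shorter by e gains the ratio of two values of the strictly increasing
    theta. *)
Lemma cycle_gain_uniform (R : realType) (alpha n c d eta e : R)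
    (q := c ^+ 2 + d ^+ 2) :
  0 < alpha -> 0 <= n -> 0 < q -> 0 < eta -> 0 < e ->
  exists2 r : R, r < 1 & forall t s : R,
    tau21 alpha n c d eta <= t -> 0 < s <= eta ->
    tau21 alpha n c d eta + e <= t \/ s <= eta - e ->
    cycle_gain alpha n q t s <= r.
Proof.
move=> a0 n0 q0 eta0 e0; set tau := tau21 _ _ _ _ _.
(* theta is controlled on nonnegative arguments only, and eta - e may be
   negative. *)
pose f : R := Num.max 0 (eta - e).
have f0 : 0 <= f by rewrite le_max lexx.
have fe : f < eta by rewrite gt_max eta0 /=; lra.
have qf : 0 <= q * f by rewrite mulr_ge0 // ltW.
have qe : 0 < q * eta by rewrite mulr_gt0.
have [mf0 _] := theta_root qf; have [me0 _] := theta_root (ltW qe).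
exists (Num.max (expR (- alpha * e)) (theta (q * f) / theta (q * eta))).
  rewrite gt_max ltr_pdivrMr // mul1r theta_mono ?ltr_pM2l // andbT.
  by rewrite expR_lt1 mulNr oppr_lt0 mulr_gt0.
move=> t s tt /andP[s0 se] ts; rewrite le_max; apply/orP.
case: ts => [te|sf]; [left|right].
  have -> : cycle_gain alpha n q t s =
      expR (- alpha * e) * cycle_gain alpha n q (t - e) s.
    rewrite /cycle_gain [RHS]mulrCA -expRD; congr (_ * expR _); ring.
  rewrite ler_piMr ?expR_ge0 //.
  by apply: (@cycle_gain_le1 _ _ _ c d eta); rewrite ?(ltW s0) // -/tau; lra.
have sf' : s <= f by rewrite le_max sf orbT.
have -> : theta (q * f) / theta (q * eta) =
    theta (q * f) / theta (q * eta) * 1 by rewrite mulr1.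
have h : cycle_gain alpha n q tau eta <= 1.
  by apply: (@cycle_gain_le1 _ _ _ c d eta); rewrite // (ltW eta0) lexx.
have r0 : 0 <= theta (q * f) / theta (q * eta) by rewrite divr_ge0 // ltW.
apply: le_trans (ler_wpM2l r0 h).
have -> : theta (q * f) / theta (q * eta) * cycle_gain alpha n q tau eta =
    expR (n * eta) * theta (q * f) * expR (- alpha * tau).
  by rewrite /cycle_gain; field; rewrite gt_eqF.
have qs : 0 <= q * s by rewrite mulr_ge0 // ltW.
have [ms0 _] := theta_root qs.
apply: ler_pM; rewrite ?mulr_ge0 ?expR_ge0 // ?(ltW ms0) //.
  apply: ler_pM; rewrite ?expR_ge0 ?(ltW ms0) // ?ler_expR ?ler_wpM2l //.
  by rewrite theta_homo // ler_wpM2l // ltW.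
by rewrite ler_expR !mulNr lerN2 ler_wpM2l // ltW.
Qed.

(** * A contraction criterion *)

(** The limit l of g satisfies l <= r l, because contractions by r occur
    arbitrarily late. *)
Lemma cvg0_contraction (R : realType) (g : nat -> R) (r : R) :
  (forall k, 0 <= g k) -> (forall k, g k.+1 <= g k) -> r < 1 ->
  (forall N, exists2 k, (N <= k)%N & g k.+1 <= r * g k) ->
  g k @[k --> \oo] --> 0.
Proof.
move=> g0 gS r1 hr.
have gh : {homo g : n m / (n <= m)%N >-> m <= n}.
  by apply/nonincreasing_seqP.
have lb : has_lbound (range g) by exists 0 => _ [k _ <-].
have gl := nonincreasing_cvgn gh lb; set l := inf _ in gl.
have lg k : l <= g k.
  by rewrite -(cvg_lim _ gl) //; apply: nonincreasing_cvgn_ge => //; apply/cvg_ex; exists l.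
have l0 : 0 <= l by apply: lb_le_inf => [|_ [k _ <-] //]; exists (g 0%N), 0%N.
suff -> : 0 = l by [].
apply/le_anti; rewrite l0 /= leNgt; apply/negP => l_gt0.
pose r' := Num.max r 0.
have r'1 : r' < 1 by rewrite gt_max r1 ltr01.
have r'0 : 0 <= r' by rewrite le_max lexx orbT.
(* Once g k < l + l (1 - r'), a contraction would push g below l:
   r' (2 - r') < 1. *)
have : 0 < l * (1 - r') by rewrite mulr_gt0 // subr_gt0.
move/cvgrPdist_lt : gl => /[apply] -[N _ hN].
have [k Nk gk] := hr N.
have := hN k Nk; rewrite distrC ger0_norm ?subr_ge0 // => hk.
have : g k.+1 <= r' * g k by rewrite (le_trans gk) // ler_wpM2r // le_max lexx.
have := lg k.+1; have := lg k => h1 h2 h3.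
have : r' * (g k - l) <= g k - l by rewrite ler_piMl ?subr_ge0 // ltW.
by nra.
Qed.

(** * Switching signals *)

Lemma switching_times_mono (R : realType) (sigma : R -> mode) (d : nat -> R) :
  switching_times sigma d -> {homo d : m n / (m <= n)%N >-> m <= n}.
Proof. by case=> _ dS _ _ _; apply/nondecreasing_seqP => n; apply: ltW. Qed.

Lemma switching_times_ge0 (R : realType) (sigma : R -> mode) (d : nat -> R) :
  switching_times sigma d -> forall k, 0 <= d k.
Proof.
move=> hd k; have [d0 _ _ _ _] := hd.
by rewrite -d0 (switching_times_mono hd).
Qed.

(** Two sequences of switching times that agree up to index k cannot differ at
    k + 1: the one switching later would keep the signal constant across a
    discontinuity of the other. *)
Lemma switching_times_unique (R : realType) (sigma : R -> mode)
    (d d' : nat -> R) :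
  switching_times sigma d -> switching_times sigma d' -> d =1 d'.
Proof.
have step (d1 d2 : nat -> R) k : switching_times sigma d1 ->
    switching_times sigma d2 -> d1 k = d2 k -> d2 k.+1 <= d1 k.+1.
  move=> [_ dS _ _ dN] [_ _ _ dC _] dk; rewrite leNgt; apply/negP => lt12.
  by apply: (dN k); rewrite dk; apply: dC; rewrite -dk ltW ?dS.
move=> hd hd'; elim=> [|k IH]; first by case: hd => -> _ _ _ _; case: hd'.
by apply/le_anti; rewrite !step.
Qed.

Lemma switching_modes (R : realType) (sigma : R -> mode) (d : nat -> R) :
  switching_times sigma d -> sigma 0 = Mode1 ->
  forall k, sigma (d (2 * k)%N) = Mode1 /\ sigma (d (2 * k).+1) = Mode2.
Proof.
move=> [d0 _ _ _ dN] s0.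
have flip j : sigma (d j) = Mode1 -> sigma (d j.+1) = Mode2.
  by move=> e; have := dN j; rewrite e; case: (sigma _).
have flop j : sigma (d j) = Mode2 -> sigma (d j.+1) = Mode1.
  by move=> e; have := dN j; rewrite e; case: (sigma _).
elim=> [|k [_ IH]]; first by rewrite muln0 d0 s0; split=> //; apply: flip; rewrite d0.
have -> : (2 * k.+1 = (2 * k).+2)%N by rewrite mulnS.
by have e := flop _ IH; split=> //; apply: flip.
Qed.

Lemma switching_cover (R : realType) (sigma : R -> mode) (d : nat -> R) :
  switching_times sigma d ->
  forall N t, d (2 * N)%N <= t ->
    exists2 k, (N <= k)%N & d (2 * k)%N <= t <= d (2 * k).+2.
Proof.
move=> hd N t dt; have [_ _ dy _ _] := hd.
have [m tm] : exists m, t < d (2 * (N + m))%N.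
  move/cvgryPgt : dy => /(_ t) [m _ hm]; exists m; apply: hm => /=.
  by rewrite mulnDr mul2n -addnn; lia.
elim: m tm => [|m IH tm]; first by rewrite addn0 ltNge dt.
have [/IH//|le] := ltP t (d (2 * (N + m))%N).
exists (N + m)%N; first exact: leq_addr.
rewrite le; move: tm; rewrite addnS mulnS => /ltW; exact.
Qed.

Lemma switched_solves_on (R : realType) (A1 A2 : 'M[R]_2) (sigma : R -> mode)
    (d : nat -> R) (x : R -> 'cV[R]_2) :
  switching_times sigma d -> switched_solution A1 A2 sigma x ->
  forall k, solves_on (subsystem A1 A2 (sigma (d k))) (d k) (d k.+1) x.
Proof.
move=> hd [cx dx] k i; have [_ _ _ dC _] := hd.
have dk0 := switching_times_ge0 hd k; split.
  have : {within `[d k, d k.+1], continuous x}.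
    apply: continuous_subspaceW cx => t /=; rewrite in_itv /= => /andP[+ _].
    exact: le_trans.
  move=> c t.
  have hi := @coord_continuous _ _ _ i ord0 (x t).
  exact: (cvg_comp _ _ (c t) hi).
move=> t /andP[dt td].
have sE s : d k < s < d k.+1 -> sigma s = sigma (d k).
  by move=> /andP[/ltW ds sd]; apply: dC; rewrite ds.
apply: is_derive_coord; rewrite -(sE t) ?dt //; apply: dx.
  exact: le_lt_trans dt.
have : \forall s \near t, s \in `]d k, d k.+1[.
  by apply: near_in_itvoo; rewrite in_itv /= dt.
by apply: filterS => s; rewrite in_itv /= => /sE ->; rewrite (sE t) ?dt.
Qed.

(** * Growth over one cycle *)

(** All that is retained of the dynamics: h stands for the norm of P1^-1 x along
    a solution and d for the switching times. *)
Definition cycle_growth (R : realType) (alpha n q : R) (d : nat -> R)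
    (h : R -> R) : Prop :=
  forall k,
    (forall t, d (2 * k)%N <= t <= d (2 * k).+1 ->
      h t = expR (- alpha * (t - d (2 * k)%N)) * h (d (2 * k)%N)) /\
    (forall t, d (2 * k).+1 <= t <= d (2 * k).+2 ->
      h t <= expR (n * (t - d (2 * k).+1)) * theta (q * (t - d (2 * k).+1)) *
        h (d (2 * k).+1)).

Lemma switched_cycle_growth (R : realType) (alpha beta n a b c d : R)
    (A1 A2 P1 P2 : 'M[R]_2) (sigma : R -> mode) (dt : nat -> R)
    (x : R -> 'cV[R]_2) :
  P1 \in unitmx -> P2 \in unitmx ->
  A1 = P1 *m mx22 (- alpha) beta (- beta) (- alpha) *m invmx P1 ->
  A2 = P2 *m mx22 n 1 0 n *m invmx P2 ->
  invmx P2 *m P1 = mx22 a b c d -> (a * d - b * c) ^+ 2 = 1 ->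
  switching_times sigma dt -> sigma 0 = Mode1 ->
  switched_solution A1 A2 sigma x ->
  cycle_growth alpha n (c ^+ 2 + d ^+ 2) dt (fun t => enorm (invmx P1 *m x t)).
Proof.
move=> P1u P2u A1E A2E ME e2 hd s0 sx k.
have [m1 m2] := switching_modes hd s0 k.
have := switched_solves_on hd sx (2 * k)%N; rewrite m1 /= A1E => /(solves_on_conj P1u) h1.
have := switched_solves_on hd sx (2 * k).+1; rewrite m2 /= A2E => /(solves_on_conj P2u) h2.
split=> t tk; first exact: (spiral_enorm h1).
have := jordan_flow h2 tk.
have Z s : invmx P2 *m x s = mx22 a b c d *m (invmx P1 *m x s).
  by rewrite -ME -mulmxA mulKVmx.
rewrite !Z; set u := dt _; set e := expR _ => zE.
have e_gt0 : 0 < e := expR_gt0 _.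
have tu : 0 <= t - u by rewrite subr_ge0; case/andP: tk.
(* The shear bound applies to the state freed from its scalar factor e. *)
have := @conj_shear_enorm _ a b c d (t - u) (invmx P1 *m x u)
  (e^-1 *: (invmx P1 *m x t)) e2 tu.
rewrite -scalemxAr zE scalerA mulVf ?gt_eqF // scale1r => /(_ erefl).
by rewrite enormZ ?invr_ge0 ?(ltW e_gt0) // ler_pdivrMl // mulrA.
Qed.

Lemma cycle_growth_gain (R : realType) (alpha n q : R) (sigma : R -> mode)
    (d : nat -> R) (h : R -> R) :
  switching_times sigma d -> cycle_growth alpha n q d h ->
  forall k, h (d (2 * k.+1)%N) <=
    cycle_gain alpha n q (stay1 d k) (stay2 d k) * h (d (2 * k)%N).
Proof.
move=> [_ dS _ _ _] gh k; have [h1 h2] := gh k; rewrite mulnS.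
have := h2 (d (2 * k).+2); rewrite lexx ltW ?dS // => /(_ isT).
rewrite (h1 (d (2 * k).+1)); first by rewrite mulrA.
by rewrite lexx ltW ?dS.
Qed.

(** The constant is at least 1, which takes care of the times spent in mode 1. *)
Lemma cycle_growth_bound (R : realType) (alpha n q eta : R)
    (sigma : R -> mode) (d : nat -> R) (h : R -> R) :
  0 <= alpha -> 0 <= n -> 0 < q -> 0 < eta -> (forall t, 0 <= h t) ->
  switching_times sigma d -> cycle_growth alpha n q d h ->
  (forall k, stay2 d k <= eta) ->
  forall k t, d (2 * k)%N <= t <= d (2 * k).+2 ->
    h t <= expR (n * eta) * theta (q * eta) * h (d (2 * k)%N).
Proof.
move=> a0 n0 q0 eta0 h0 [_ dS _ _ _] gh se k t /andP[dt td].
have [h1 h2] := gh k.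
have shrink s : d (2 * k)%N <= s <= d (2 * k).+1 -> h s <= h (d (2 * k)%N).
  move=> hs; rewrite (h1 _ hs) ler_piMl // expR_le1 mulNr oppr_le0 mulr_ge0 //.
  by rewrite subr_ge0; case/andP: hs.
have qe0 : 0 <= q * eta by rewrite mulr_ge0 // ltW.
have [m0 m2] := theta_root qe0.
have [td1|dt1] := leP t (d (2 * k).+1).
  apply: le_trans (shrink t _) _; first by rewrite dt.
  rewrite ler_peMl // mulr_ege1 //.
    by rewrite -[leLHS]expR0 ler_expR mulr_ge0 // ltW.
  have : 0 <= q * eta * theta (q * eta) by rewrite mulr_ge0 // ltW.
  by nra.
have r0 : 0 <= t - d (2 * k).+1 by rewrite subr_ge0 ltW.
have re : t - d (2 * k).+1 <= eta.
  by apply: le_trans (se k); rewrite lerB.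
have [m0' _] := theta_root (mulr_ge0 (ltW q0) r0).
apply: (le_trans (h2 t _)); first by rewrite ltW.
apply: ler_pM; rewrite ?mulr_ge0 ?expR_ge0 // ?(ltW m0') //; last first.
  by apply: shrink; rewrite lexx ltW ?dS.
apply: ler_pM; rewrite ?expR_ge0 ?(ltW m0') // ?ler_expR ?ler_wpM2l //.
by rewrite theta_homo ?mulr_ge0 ?ler_wpM2l // ltW.
Qed.

Lemma not_cvg_gap (R : realType) (tau eta : R) (t s : nat -> R) :
  (forall k, tau <= t k) -> (forall k, s k <= eta) ->
  ~ ((t k, s k) @[k --> \oo] --> (tau, eta)) ->
  exists2 e : R, 0 < e & forall N, exists2 k, (N <= k)%N &
    tau + e <= t k \/ s k <= eta - e.
Proof.
move=> tt se ncvg; apply: contrapT => hN; apply: ncvg.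
have small e : 0 < e -> \forall k \near \oo, t k < tau + e /\ eta - e < s k.
  move=> e0; apply: contrapT => ne; apply: hN; exists e => // N.
  apply: contrapT => nk; apply: ne; exists N => // k /= Nk.
  rewrite !ltNge; split; apply/negP => hk; apply: nk; exists k => //.
    by left.
  by right.
apply: (@cvg_pair _ _ _ _ (nbhs tau) (nbhs eta)); apply/cvgrPdist_lt => e /small;
  apply: filterS => k [h1 h2].
  by rewrite distrC ger0_norm ?subr_ge0 // ltrBlDl.
by rewrite ger0_norm ?subr_ge0 // ltrBlDr -ltrBlDl.
Qed.

Lemma cycle_growth_nonincr (R : realType) (alpha n c d eta : R)
    (q := c ^+ 2 + d ^+ 2) (sigma : R -> mode) (dt : nat -> R) (h : R -> R) :
  0 < alpha -> 0 <= n -> 0 < q -> 0 < eta -> (forall t, 0 <= h t) ->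
  switching_times sigma dt -> cycle_growth alpha n q dt h ->
  (forall k, tau21 alpha n c d eta <= stay1 dt k /\ stay2 dt k <= eta) ->
  forall k, h (dt (2 * k.+1)%N) <= h (dt (2 * k)%N).
Proof.
move=> a0 n0 q0 eta0 h0 hd gh st k; have [tt se] := st k.
apply: le_trans (cycle_growth_gain hd gh k) _; rewrite ler_piMl //.
apply: (@cycle_gain_le1 _ _ _ c d eta) => //; rewrite se andbT subr_ge0.
by case: hd => _ dS _ _ _; apply: ltW.
Qed.

Lemma cycle_growth_stable (R : realType) (alpha n c d eta : R)
    (q := c ^+ 2 + d ^+ 2) (sigma : R -> mode) (dt : nat -> R) (h : R -> R) :
  0 < alpha -> 0 <= n -> 0 < q -> 0 < eta -> (forall t, 0 <= h t) ->
  switching_times sigma dt -> cycle_growth alpha n q dt h ->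
  (forall k, tau21 alpha n c d eta <= stay1 dt k /\ stay2 dt k <= eta) ->
  forall t, 0 <= t -> h t <= expR (n * eta) * theta (q * eta) * h 0.
Proof.
move=> a0 n0 q0 eta0 h0 hd gh st t t0.
have mono := cycle_growth_nonincr a0 n0 q0 eta0 h0 hd gh st.
have d0 : dt 0%N = 0 by case: hd.
have [k _ tk] : exists2 k, (0 <= k)%N & dt (2 * k)%N <= t <= dt (2 * k).+2.
  by apply: (switching_cover hd); rewrite muln0 d0.
have se j := (st j).2.
apply: le_trans (cycle_growth_bound (ltW a0) n0 q0 eta0 h0 hd gh se tk) _.
have [m0 _] := theta_root (mulr_ge0 (ltW q0) (ltW eta0)).
rewrite ler_wpM2l ?mulr_ge0 ?expR_ge0 ?(ltW m0) //.
by elim: k {tk} => [|k IH]; [rewrite muln0 d0|exact: le_trans IH].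
Qed.

Lemma cycle_growth_cvg0 (R : realType) (alpha n c d eta : R)
    (q := c ^+ 2 + d ^+ 2) (sigma : R -> mode) (dt : nat -> R) (h : R -> R) :
  0 < alpha -> 0 <= n -> 0 < q -> 0 < eta -> (forall t, 0 <= h t) ->
  switching_times sigma dt -> cycle_growth alpha n q dt h ->
  (forall k, tau21 alpha n c d eta <= stay1 dt k /\ stay2 dt k <= eta) ->
  ~ ((stay1 dt k, stay2 dt k) @[k --> \oo] --> (tau21 alpha n c d eta, eta)) ->
  h t @[t --> +oo] --> 0.
Proof.
move=> a0 n0 q0 eta0 h0 hd gh st ncvg.
have mono := cycle_growth_nonincr a0 n0 q0 eta0 h0 hd gh st.
have [||e e0 gap] := not_cvg_gap _ _ ncvg; [by move=> k; case: (st k)..|].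
have [r r1 hr] := cycle_gain_uniform a0 n0 q0 eta0 e0.
have g0 : h (dt (2 * k)%N) @[k --> \oo] --> 0.
  apply: (@cvg0_contraction _ _ r) => // N.
  have [k Nk gk] := gap N; exists k => //.
  apply: le_trans (cycle_growth_gain hd gh k) _; rewrite ler_wpM2r //.
  have [tt se] := st k; apply: hr => //; rewrite se andbT subr_gt0.
  by case: hd => _ dS _ _ _.
have [m0 _] := theta_root (mulr_ge0 (ltW q0) (ltW eta0)).
set B := expR (n * eta) * theta (q * eta).
have B0 : 0 < B by rewrite mulr_gt0 ?expR_gt0.
apply/cvgrPdist_lt => eps eps0.
move/cvgrPdist_lt : g0 => /(_ (eps / B)); rewrite divr_gt0 // => /(_ isT) [N _ hN].
exists (dt (2 * N)%N); split; first exact: num_real.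
move=> t /ltW/(switching_cover hd)[k Nk tk].
rewrite sub0r normrN ger0_norm //.
have := hN k Nk; rewrite sub0r normrN ger0_norm // ltr_pdivlMr // mulrC.
have se j := (st j).2.
exact/le_lt_trans/(cycle_growth_bound (ltW a0) n0 q0 eta0 h0 hd gh se tk).
Qed.

(** * Stability of the switched system *)

Theorem theorem9p2 (R : realType) (alpha1 beta1 n2 a b c d eta : R)
    (A1 A2 P1 P2 : 'M[R]_2)
    (alpha1_gt0 : 0 < alpha1) (beta1_neq0 : beta1 <> 0) (n2_ge0 : 0 <= n2)
    (P1_unit : P1 \in unitmx) (P2_unit : P2 \in unitmx)
    (A1E : A1 = P1 *m mx22 (- alpha1) beta1 (- beta1) (- alpha1) *m invmx P1)
    (A2E : A2 = P2 *m mx22 n2 1 0 n2 *m invmx P2)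
    (ME : invmx P2 *m P1 = mx22 a b c d)
    (detM : \det (invmx P2 *m P1) = 1 \/ \det (invmx P2 *m P1) = -1)
    (eta_gt0 : 0 < eta) :
  (forall sigma : R -> mode,
      sigS (tau21 alpha1 n2 c d eta) eta sigma ->
      switched_stable A1 A2 sigma) /\
  (forall sigma : R -> mode,
      sigS' (tau21 alpha1 n2 c d eta) eta sigma ->
      switched_asymp_stable A1 A2 sigma).
Proof.
have e2 : (a * d - b * c) ^+ 2 = 1.
  by move: detM; rewrite ME det_mx22 => -[->|->]; rewrite ?sqrrN expr1n.
have q0 := row_sqr_gt0 e2.
have [m0 _] := theta_root (mulr_ge0 (ltW q0) (ltW eta_gt0)).
have [C1 C1_gt0 hC1] := enorm_mulmx_le (invmx P1).
have [C2 C2_gt0 hC2] := enorm_mulmx_le P1.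
pose B := expR (n2 * eta) * theta ((c ^+ 2 + d ^+ 2) * eta).
have B0 : 0 < B by rewrite mulr_gt0 ?expR_gt0.
have xle (x : R -> 'cV[R]_2) (t : R) :
    enorm (x t) <= C2 * enorm (invmx P1 *m x t).
  by have := hC2 (invmx P1 *m x t); rewrite mulKVmx.
have stab sigma : sigS (tau21 alpha1 n2 c d eta) eta sigma ->
    switched_stable A1 A2 sigma.
  move=> [s0 [dt hd st]] eps eps0.
  have D0 : 0 < C2 * B * C1 by apply: mulr_gt0 => //; apply: mulr_gt0.
  exists (eps / (C2 * B * C1)); first exact: divr_gt0.
  move=> x sx x0 t t0.
  have gh := switched_cycle_growth P1_unit P2_unit A1E A2E ME e2 hd s0 sx.
  have yt := cycle_growth_stable alpha1_gt0 n2_ge0 q0 eta_gt0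
    (fun t => enorm_ge0 _) hd gh st (ltW t0).
  have xt : enorm (x t) <= C2 * (B * (C1 * enorm (x 0))).
    apply: le_trans (xle x t) (ler_wpM2l (ltW C2_gt0) _).
    exact: le_trans yt (ler_wpM2l (ltW B0) (hC1 _)).
  by apply: le_lt_trans xt _; rewrite mulrA mulrA mulrC -ltr_pdivlMr.
split=> // sigma [sS [d' hd' ncvg]]; split; first exact: stab.
have [s0 [dt hd st]] := sS => x sx.
have gh := switched_cycle_growth P1_unit P2_unit A1E A2E ME e2 hd s0 sx.
(* Admissibility and non-convergence are witnessed by two a priori different
   sequences of switching times. *)
have dE : d' = dt := funext (switching_times_unique hd' hd).
rewrite {}dE in ncvg.
have y0 := cycle_growth_cvg0 alpha1_gt0 n2_ge0 q0 eta_gt0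
  (fun t => enorm_ge0 _) hd gh st ncvg.
apply: (@squeeze_cvgr _ _ _ _ (fun=> 0) (fun t => C2 * enorm (invmx P1 *m x t))).
- by apply: nearW => t; rewrite enorm_ge0 xle.
- exact: cvg_cst.
- by rewrite -(mulr0 C2); apply: cvgM; [exact: cvg_cst|].
Qed.
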